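(* Let $n\ge1$ and let $\mathcal{G}$ be a subgroup with $\mathcal{M}^+_{2n}\le\mathcal{G}\le\mathcal{C}^p_{2n}$, and let $G\le\mathrm{O}(2n)$ be the set of symplectic maps associated to elements of $\mathcal{G}$. Then for every integer $t\ge1$, $$\mathcal{F}^+_t(\mathcal{G})=\frac{1}{|G|}\sum_{S\in G}\left[\frac{f_+(S)+c_+(S)}{2}\right]^{t-1},$$ where $f_+(S)=|\{v\in\mathbb{F}_2^{2n,+}:Sv=v\}|$ and $c_+(S)=|\{v\in\mathbb{F}_2^{2n,+}:Sv=v+j\}|$.
   Context: All binary arithmetic is over $\mathbb{F}_2$. $\chi_1,\dots,\chi_{2n}$ are Hermitian operators on a $2^n$-dimensional Hilbert space with $\chi_i\chi_k+\chi_k\chi_i=2\delta_{ik}I$; $\omega_L$ is the strictly lower triangular binary matrix of ones below the diagonal; $\mu(v)=i^{\,v^T\omega_L v}\chi_1^{v_1}\cdots\chi_{2n}^{v_{2n}}$. $j=(1,\dots,1)^T$, $\mathbb{F}_2^{2n,+}$ is the set of even-weight vectors, $\mathcal{M}^+_{2n}=\{i^a\mu(v):a\in\mathbb{Z}_4,v\in\mathbb{F}_2^{2n,+}\}$. The Majorana Clifford group $\mathcal{C}_{2n}$ consists of unitaries $\gamma$ with $\gamma\mu(v)\gamma^\dagger=c(v)\mu(S(v))$ for all $v$ (some $c,S$; $S$ is the associated symplectic map), and $\mathcal{C}^p_{2n}=\{\gamma\in\mathcal{C}_{2n}:\gamma\mu(j)=\mu(j)\gamma\}$, whose associated maps lie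 in $\mathrm{O}(2n)=\{A: A^TA=AA^T=I\}$. Let $\Pi_+=\frac12(I+\mu(j))$ be the projector onto the even-parity subspace. For a parity-preserving group $\mathcal{G}$ of unitaries, the parity-restricted frame potential is $\mathcal{F}^+_t(\mathcal{G})=\mathbb{E}_{U,V\in\mathcal{G}}|\operatorname{tr}(\Pi_+UV^\dagger)|^{2t}=\mathbb{E}_{U\in\mathcal{G}}|\operatorname{tr}(\Pi_+U)|^{2t}$, the expectation being uniform over $\mathcal{G}$ modulo global phases. *)

(* Defs.v *)
From HB Require Import structures.
From mathcomp Require Import all_boot all_order all_algebra all_field.
Set Implicit Arguments. Unset Strict Implicit. Unset Printing Implicit Defensive.
Import Order.TTheory GRing.Theory Num.Theory.
Local Open Scope ring_scope.

(* C is an arbitrary numeric closed field (e.g. the complex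
   numbers); operators on the 2^n-dimensional Hilbert space are matrices
   'M[C]_(2^n).  Binary vectors are column vectors 'cV['F_2]_(2n). *)

Definition adj (C : numClosedFieldType) (m : nat) (A : 'M[C]_m) : 'M[C]_m :=
  (map_mx Num.conj A)^T.

Definition unitary (C : numClosedFieldType) (m : nat) (U : 'M[C]_m) : Prop :=
  U *m adj U = 1%:M /\ adj U *m U = 1%:M.

Definition bvec (n : nat) := 'cV['F_2]_(2 * n).

Definition omegaL (n : nat) : 'M['F_2]_(2 * n) :=
  \matrix_(i, k) (if (k < i)%N then 1 else 0).

Definition jvec (n : nat) : bvec n := const_mx 1.

Definition even_wt (n : nat) (v : bvec n) : bool :=
  ~~ odd #|[set i : 'I_(2 * n) | v i 0 != 0]|.

(* mu(v) = i^(v^T omega_L v) chi_1^{v_1} ... chi_{2n}^{v_{2n}}, where the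
   exponent v^T omega_L v is computed in F_2. *)
Definition mu (C : numClosedFieldType) (n : nat)
    (chi : 'I_(2 * n) -> 'M[C]_(2 ^ n)) (v : bvec n) : 'M[C]_(2 ^ n) :=
  (if ((v^T *m omegaL n *m v) 0 0 == 1) then 'i else 1) *:
  foldr (fun k A => (if v k 0 == 1 then chi k else 1%:M) *m A) 1%:M
        (enum 'I_(2 * n)).

Definition majorana (C : numClosedFieldType) (n : nat)
    (chi : 'I_(2 * n) -> 'M[C]_(2 ^ n)) : Prop :=
  (forall k, adj (chi k) = chi k) /\
  (forall i k, chi i *m chi k + chi k *m chi i =
               (if i == k then 2%:R else 0) %:M).

Definition assoc_map (C : numClosedFieldType) (n : nat)
    (chi : 'I_(2 * n) -> 'M[C]_(2 ^ n)) (U : 'M[C]_(2 ^ n))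
    (S : bvec n -> bvec n) : Prop :=
  exists c : bvec n -> C, forall v, U *m mu chi v *m adj U = c v *: mu chi (S v).

Definition in_Clifford (C : numClosedFieldType) (n : nat)
    (chi : 'I_(2 * n) -> 'M[C]_(2 ^ n)) (U : 'M[C]_(2 ^ n)) : Prop :=
  unitary U /\ exists S : bvec n -> bvec n, assoc_map chi U S.

Definition in_Clifford_p (C : numClosedFieldType) (n : nat)
    (chi : 'I_(2 * n) -> 'M[C]_(2 ^ n)) (U : 'M[C]_(2 ^ n)) : Prop :=
  in_Clifford chi U /\ U *m mu chi (jvec n) = mu chi (jvec n) *m U.

Definition is_subgroup (C : numClosedFieldType) (m : nat)
    (Gp : 'M[C]_m -> Prop) : Prop :=
  [/\ Gp 1%:M,
      forall U V, Gp U -> Gp V -> Gp (U *m V) &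
      forall U, Gp U -> U \in unitmx /\ Gp (invmx U)].

Definition between_Mplus_Cp (C : numClosedFieldType) (n : nat)
    (chi : 'I_(2 * n) -> 'M[C]_(2 ^ n)) (Gp : 'M[C]_(2 ^ n) -> Prop) : Prop :=
  (forall (a : nat) (v : bvec n), even_wt v -> Gp ('i ^+ a *: mu chi v)) /\
  (forall U, Gp U -> in_Clifford_p chi U).

Definition phase_transversal (C : numClosedFieldType) (m : nat)
    (Gp : 'M[C]_m -> Prop) (reps : seq 'M[C]_m) : Prop :=
  [/\ uniq reps,
      forall U, U \in reps -> Gp U,
      forall U, Gp U -> exists2 V, V \in reps & exists c : C, U = c *: V &
      forall U V, U \in reps -> V \in reps -> (exists c : C, U = c *: V) -> U = V].

Definition Pi_plus (C : numClosedFieldType) (n : nat)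
    (chi : 'I_(2 * n) -> 'M[C]_(2 ^ n)) : 'M[C]_(2 ^ n) :=
  (2%:R)^-1 *: (1%:M + mu chi (jvec n)).

(* parity-restricted frame potential, the uniform expectation over Gp modulo
   global phases being computed over a set of representatives reps:
   F^+_t = E_{U,V} |tr(Pi_+ U V^dagger)|^{2t} *)
Definition frame_pot_plus (C : numClosedFieldType) (n : nat)
    (chi : 'I_(2 * n) -> 'M[C]_(2 ^ n)) (reps : seq 'M[C]_(2 ^ n)) (t : nat) : C :=
  ((size reps)%:R ^+ 2)^-1 *
  \sum_(U <- reps) \sum_(V <- reps)
     `| \tr (Pi_plus chi *m (U *m adj V)) | ^+ (2 * t).

Definition f_plus (n : nat) (S : {ffun bvec n -> bvec n}) : nat :=
  #|[set v : bvec n | even_wt v && (S v == v)]|.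

Definition c_plus (n : nat) (S : {ffun bvec n -> bvec n}) : nat :=
  #|[set v : bvec n | even_wt v && (S v == v + jvec n)]|.

(* Main.v *)
Require Import Defs.
From mathcomp Require Import all_boot all_order all_algebra all_field.
Set Implicit Arguments. Unset Strict Implicit. Unset Printing Implicit Defensive.
Import GRing.Theory Num.Theory.
Local Open Scope ring_scope.

(** The operators mu(v) form an orthogonal operator basis, so averaging A over conjugation
    by the even mu(v) projects A onto the span of 1 and mu(j).  Taking A = Pi_+ U gives
      |tr(Pi_+ U)|^2 = (1/2) sum_{v even} x_U(v),
    where x_U is supported on E = {v even : S v = v or S v = v + j}, and is a character on E
    because U mu(v) Pi_+ U^dagger = x_U(v) mu(v) Pi_+ there.  Hence |tr(Pi_+ U)|^2 is 0 or
    K = |E|/2 = (f_+(S) + c_+(S))/2.  Replacing U by U mu(w), w even, keeps S and multiplies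
    x_U(v) by (-1)^(v.w), so that summing over w only leaves v = 0 and v = j: the mean of
    |tr(Pi_+ U mu(w))|^2 over w is 1, and that of its t-th power is K^(t-1).  Finally the
    kernel of U |-> S modulo phases is {mu(w) : w even}, so the average over the group is
    the average over S in G of these coset means. *)

(** * Arithmetic in F_2 *)

Lemma F2_cases (a : 'F_2) : a = 0 \/ a = 1.
Proof. by case: a => [[|[|//]] lt_a2]; [left | right]; apply: val_inj. Qed.

Lemma F2_addrr (a : 'F_2) : a + a = 0.
Proof. by case: (F2_cases a) => ->; apply: val_inj. Qed.

Lemma F2_neq0 (a : 'F_2) : (a != 0) = (a == 1).
Proof. by case: (F2_cases a) => ->. Qed.

Lemma F2_natr_eq0 (m : nat) : ((m%:R : 'F_2) == 0) = ~~ odd m.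
Proof.
rewrite -[m in LHS]odd_double_half -addnn !natrD F2_addrr addr0.
by case: (odd m).
Qed.

Lemma bvec_addrr (n : nat) (v : bvec n) : v + v = 0.
Proof. by apply/matrixP=> i j; rewrite !mxE F2_addrr. Qed.

Lemma bvec_addrK (n : nat) (w v : bvec n) : v + w + w = v.
Proof. by rewrite -addrA bvec_addrr addr0. Qed.

(** * Signs [(-1)^a] with exponent in F_2 *)

Definition sgn {C : numClosedFieldType} (a : 'F_2) : C := if a == 0 then 1 else -1.

Section Sign.
Variable C : numClosedFieldType.
Local Notation sgn := (@sgn C).

Lemma sgn0 : sgn 0 = 1. Proof. by rewrite /sgn eqxx. Qed.
Lemma sgn1 : sgn 1 = -1. Proof. by []. Qed.

Lemma sgnD (a b : 'F_2) : sgn (a + b) = sgn a * sgn b.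
Proof.
case: (F2_cases a) => ->; first by rewrite add0r sgn0 mul1r.
case: (F2_cases b) => ->; first by rewrite addr0 sgn0 mulr1.
by rewrite F2_addrr sgn0 sgn1 mulrNN mul1r.
Qed.

Lemma sgn_sqr (a : 'F_2) : sgn a * sgn a = 1.
Proof. by rewrite -sgnD F2_addrr sgn0. Qed.

Lemma sgn_neq0 (a : 'F_2) : sgn a != 0.
Proof. by case: (F2_cases a) => ->; rewrite ?sgn0 ?sgn1 ?oppr_eq0 oner_eq0. Qed.

End Sign.

(** * Binary vectors *)

Section BinaryVectors.
Variable n : nat.
Implicit Types v w : bvec n.

Definition wt v : 'F_2 := \sum_i v i 0.
Definition dot v w : 'F_2 := \sum_i v i 0 * w i 0.
Definition evec (k : 'I_(2 * n)) : bvec n := \col_i (i == k)%:R.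

(** Trades the parity of a cardinality for the vanishing of a linear form, so that even vectors can
    be handled as a subspace. *)
Lemma even_wtE v : even_wt v = (wt v == 0).
Proof.
rewrite /even_wt -F2_natr_eq0 -sum1_card natr_sum /wt; congr (_ == _).
rewrite [RHS](bigID (fun i => v i 0 != 0)) /= [X in _ = _ + X]big1 ?addr0.
  apply: eq_big => [i|i]; rewrite inE //.
  by rewrite F2_neq0 => /eqP->.
by move=> i; rewrite negbK => /eqP.
Qed.

Lemma wtD v w : wt (v + w) = wt v + wt w.
Proof. by rewrite -big_split; apply: eq_bigr => i _; rewrite mxE. Qed.

Lemma dotDl u v w : dot (u + v) w = dot u w + dot v w.
Proof. by rewrite -big_split; apply: eq_bigr => i _; rewrite mxE mulrDl. Qed.

Lemma dotC v w : dot v w = dot w v.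
Proof. by apply: eq_bigr => i _; rewrite mulrC. Qed.

Lemma dotDr u v w : dot w (u + v) = dot w u + dot w v.
Proof. by rewrite !(dotC w) dotDl. Qed.

Lemma wt0 : wt 0 = 0.
Proof. by rewrite /wt big1 // => i _; rewrite mxE. Qed.

Lemma dot0v v : dot 0 v = 0.
Proof. by rewrite /dot big1 // => i _; rewrite mxE mul0r. Qed.

Lemma dotjv v : dot (jvec n) v = wt v.
Proof. by apply: eq_bigr => i _; rewrite mxE mul1r. Qed.

Lemma wtj : wt (jvec n) = 0.
Proof.
rewrite /wt (eq_bigr (fun=> 1)) => [|i _]; last by rewrite mxE.
by apply/eqP; rewrite big_const_ord iter_addr_0 F2_natr_eq0 mul2n odd_double.
Qed.

Lemma dot_evec v k : dot v (evec k) = v k 0.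
Proof.
rewrite /dot (bigD1 k) //= mxE eqxx mulr1 big1 ?addr0 // => i /negPf neq_ik.
by rewrite mxE neq_ik mulr0.
Qed.

Lemma wt_evec k : wt (evec k) = 1.
Proof. by rewrite -dotjv dot_evec mxE. Qed.

Lemma even0 : even_wt (0 : bvec n).
Proof. by rewrite even_wtE wt0. Qed.

Lemma evenj : even_wt (jvec n).
Proof. by rewrite even_wtE wtj. Qed.

Lemma evenD v w : even_wt v -> even_wt (w + v) = even_wt w.
Proof. by rewrite !even_wtE wtD => /eqP->; rewrite addr0. Qed.

Lemma bvec_neq0P v : v != 0 -> exists k, v k 0 = 1.
Proof.
move=> vn0; case: (pickP (fun k => v k 0 != 0)) => [k | v0].
  by rewrite F2_neq0 => /eqP; exists k.
case/eqP: vn0; apply/matrixP=> i j; rewrite (ord1 j) mxE.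
by apply/eqP; rewrite -[_ == _]negbK v0.
Qed.

Lemma bvec_neqjP v : v != jvec n -> exists k, v k 0 = 0.
Proof.
move=> vnj; have: v + jvec n != 0.
  by apply: contraNneq vnj => vj0; rewrite -[v](bvec_addrK (jvec n)) vj0 add0r.
case/bvec_neq0P=> k; rewrite !mxE => vk; exists k.
by rewrite -[LHS]addr0 -(F2_addrr 1) addrA vk F2_addrr.
Qed.

(* Exponent of the commutation sign: mu v mu w = (-1)^(sform v w) mu w mu v. *)
Definition sform v w : 'F_2 := wt v * wt w + dot v w.

(** Since [sform v (evec k) = wt v + v k 0], any coordinate where [v] differs from the constant
    [wt v] gives a witness. In the odd case one exists because [jvec n] is even. *)
Lemma sform_nondeg v : (0 < n)%N -> v != 0 -> exists w, sform v w = 1.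
Proof.
move=> n_gt0 vn0; case: (F2_cases (wt v)) => wtv.
  have [k vk] := bvec_neq0P vn0; exists (evec k).
  by rewrite /sform wtv mul0r add0r dot_evec.
have [|k vk] := @bvec_neqjP v.
  by apply: contra_eq_neq wtv => ->; rewrite wtj eq_sym oner_eq0.
by exists (evec k); rewrite /sform wtv wt_evec dot_evec vk addr0 mulr1.
Qed.

Lemma sform_even v w : even_wt v -> sform v w = dot v w.
Proof. by rewrite even_wtE /sform => /eqP->; rewrite mul0r add0r. Qed.

(** Translation by a unit vector exchanges even and odd vectors. *)
Lemma card_even : (0 < n)%N -> (2 * #|[set v : bvec n | even_wt v]|)%N = (2 ^ (2 * n))%N.
Proof.
move=> n_gt0; have n2_gt0 : (0 < 2 * n)%N by rewrite muln_gt0.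
set e := evec (Ordinal n2_gt0); set E := [set v | _].
have <-: #|bvec n| = (2 ^ (2 * n))%N by rewrite card_mx muln1 card_Fp.
rewrite -[RHS](cardC (mem E)) mul2n -addnn; congr (_ + _)%N.
rewrite -(card_imset _ (addIr e)); apply: eq_card => v; rewrite !inE.
apply/imsetP/idP => [[w] | vo].
  by rewrite inE !even_wtE => /eqP ew ->; rewrite wtD ew wt_evec.
exists (v + e); last by rewrite bvec_addrK.
by move: vo; rewrite inE !even_wtE wtD wt_evec F2_neq0 => /eqP->.
Qed.

(** With [v k = 1] and [v l = 0], translation by the even vector [e] permutes the summands and flips
    every sign, so the sum equals its own negative. *)
Lemma sum_sgn_dot (C : numClosedFieldType) v : v != 0 -> v != jvec n ->
  \sum_(w | even_wt w) sgn (dot v w) = 0 :> C.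
Proof.
move=> /bvec_neq0P[k vk] /bvec_neqjP[l vl].
set e := evec k + evec l; set s := \sum_(w | _) _.
have ev_e : even_wt e by rewrite even_wtE wtD !wt_evec F2_addrr.
have: s = - s.
  rewrite {1}/s (reindex_inj (addIr e)) -sumrN; apply: eq_big => w; first exact: evenD.
  by rewrite dotDr dotDr !dot_evec vk vl addr0 sgnD mulrN1.
by move/eqP; rewrite -subr_eq0 opprK -mulr2n mulrn_eq0 => /eqP.
Qed.

End BinaryVectors.

(** * Adjoints and unitary matrices *)

Section Adjoint.
Variables (C : numClosedFieldType) (m : nat).
Implicit Types A B : 'M[C]_m.

Lemma adjM A B : adj (A *m B) = adj B *m adj A.
Proof. by rewrite /adj map_mxM trmx_mul. Qed.

Lemma adjZ (a : C) A : adj (a *: A) = a^* *: adj A.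
Proof. by apply/matrixP=> i j; rewrite !mxE rmorphM. Qed.

Lemma adjD A B : adj (A + B) = adj A + adj B.
Proof. by apply/matrixP=> i j; rewrite !mxE rmorphD. Qed.

Lemma adjK A : adj (adj A) = A.
Proof. by apply/matrixP=> i j; rewrite !mxE conjCK. Qed.

Lemma adj1 : adj (1%:M : 'M[C]_m) = 1%:M.
Proof. by rewrite /adj map_scalar_mx rmorph1 tr_scalar_mx. Qed.

Lemma trace_adj A : \tr (adj A) = (\tr A)^*.
Proof. by rewrite /adj mxtrace_tr /mxtrace rmorph_sum; apply: eq_bigr => i _; rewrite mxE. Qed.

Lemma unitaryM A B : unitary A -> unitary B -> unitary (A *m B).
Proof.
move=> [A1 A2] [B1 B2]; split; rewrite adjM mulmxA.
  by rewrite -(mulmxA A) B1 mulmx1.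
by rewrite -(mulmxA (adj B)) A2 mulmx1.
Qed.

Lemma unitary_adj A : unitary A -> unitary (adj A).
Proof. by case=> A1 A2; split; rewrite adjK. Qed.

Lemma unitary_unitmx A : unitary A -> A \in unitmx.
Proof. by case=> /mulmx1_unit[]. Qed.

Lemma unitary_inv A : unitary A -> invmx A = adj A.
Proof.
by move=> uA; rewrite -[RHS]mul1mx -(mulVmx (unitary_unitmx uA)) -mulmxA uA.1 mulmx1.
Qed.

Lemma unitary_phase (c : C) A B :
  (0 < m)%N -> unitary A -> unitary B -> A = c *: B -> c * c^* = 1.
Proof.
move=> m_gt0 [A1 _] [B1 _] defA; move: A1.
rewrite defA adjZ -scalemxAl -scalemxAr B1 scalerA scalemx1.
move=> /matrixP/(_ (Ordinal m_gt0) (Ordinal m_gt0)).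
by rewrite !mxE eqxx.
Qed.
End Adjoint.

Lemma two_neq0 (C : numClosedFieldType) : (2%:R : C) != 0.
Proof. by rewrite pnatr_eq0. Qed.

(** * Products of Majorana operators *)

Section Majorana.
Variables (C : numClosedFieldType) (n : nat) (chi : 'I_(2 * n) -> 'M[C]_(2 ^ n)).
Hypothesis chiP : majorana chi.
Local Notation sgn := (@sgn C).
Local Notation mu := (mu chi).
Local Notation V := (bvec n).
Implicit Types (v w : V) (k l : 'I_(2 * n)) (s : seq 'I_(2 * n)).

Lemma chi_sqr k : chi k *m chi k = 1%:M.
Proof.
have := chiP.2 k k; rewrite eqxx -mulr2n -scaler_nat => chi2.
by apply: (scalerI (two_neq0 C)); rewrite chi2 scalemx1.
Qed.

Lemma chi_anticomm k l : k != l -> chi k *m chi l = - (chi l *m chi k).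
Proof.
move=> /negPf neq_kl; have := chiP.2 k l; rewrite neq_kl raddf0 => /eqP.
by rewrite addr_eq0 => /eqP.
Qed.

Definition chi_pow v k : 'M[C]_(2 ^ n) := if v k 0 == 1 then chi k else 1%:M.
Definition chi_prod v s := foldr (fun k A => chi_pow v k *m A) 1%:M s.
Definition mu_expt v : 'F_2 := (v^T *m omegaL n *m v) 0 0.
Definition mu_phase v : C := if mu_expt v == 1 then 'i else 1.

Lemma muE v : mu v = mu_phase v *: chi_prod v (enum 'I_(2 * n)).
Proof. by []. Qed.

Lemma chi_powC v w k l :
  chi_pow v k *m chi_pow w l =
  sgn ((k != l)%:R * (v k 0 * w l 0)) *: (chi_pow w l *m chi_pow v k).
Proof.
rewrite /chi_pow; case: (F2_cases (v k 0)) => -> /=.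
  by rewrite mul0r mulr0 sgn0 scale1r mul1mx mulmx1.
case: (F2_cases (w l 0)) => -> /=.
  by rewrite !mulr0 sgn0 scale1r mul1mx mulmx1.
rewrite !mulr1; case: eqVneq => [-> | neq_kl] /=; first by rewrite sgn0 scale1r.
by rewrite chi_anticomm // sgn1 scaleN1r.
Qed.

Lemma chi_pow_prodC v w k s :
  chi_pow v k *m chi_prod w s =
  sgn (\sum_(l <- s) (k != l)%:R * (v k 0 * w l 0)) *: (chi_prod w s *m chi_pow v k).
Proof.
elim: s => [|l s IHs] /=; first by rewrite big_nil sgn0 scale1r mul1mx mulmx1.
rewrite big_cons sgnD mulmxA chi_powC -scalemxAl -mulmxA IHs.
by rewrite -scalemxAr scalerA mulmxA.
Qed.

Lemma chi_prodC v w s s' :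
  chi_prod v s *m chi_prod w s' =
  sgn (\sum_(k <- s) \sum_(l <- s') (k != l)%:R * (v k 0 * w l 0)) *:
    (chi_prod w s' *m chi_prod v s).
Proof.
elim: s => [|k s IHs] /=; first by rewrite big_nil sgn0 scale1r mul1mx mulmx1.
rewrite big_cons addrC sgnD -mulmxA IHs -scalemxAr !mulmxA chi_pow_prodC.
by rewrite -scalemxAl scalerA.
Qed.

(** Reordering costs one sign for each pair [k != l] with [v k = w l = 1]. All pairs together
    contribute [wt v * wt w], and removing the diagonal subtracts [dot v w]. *)
Lemma mu_comm v w : mu v *m mu w = sgn (sform v w) *: (mu w *m mu v).
Proof.
rewrite !muE -!scalemxAl -!scalemxAr chi_prodC !scalerA; congr (_ *: _).
rewrite [LHS]mulrC -[RHS]mulrA; congr (_ * _); last exact: mulrC.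
congr (sgn _); rewrite big_enum /= /sform /wt /dot big_distrlr -big_split.
apply: eq_bigr => k _ /=; rewrite big_enum /= (bigD1 k) //= [in RHS](bigD1 k) //=.
rewrite eqxx mul0r add0r -addrA addrC -addrA F2_addrr addr0.
by apply: eq_bigr => l; rewrite eq_sym => ->; rewrite mul1r.
Qed.

Lemma chi_powD v w k : chi_pow v k *m chi_pow w k = chi_pow (v + w) k.
Proof.
rewrite /chi_pow !mxE; case: (F2_cases (v k 0)) => -> /=; first by rewrite add0r mul1mx.
by case: (F2_cases (w k 0)) => -> /=; rewrite ?addr0 ?mulmx1 ?F2_addrr ?chi_sqr.
Qed.

Lemma chi_prodD v w s :
  exists a, chi_prod v s *m chi_prod w s = sgn a *: chi_prod (v + w) s.
Proof.
elim: s => [|k s [a IHs]] /=; first by exists 0; rewrite mulmx1 sgn0 scale1r.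
have [b defb] : exists b, chi_prod v s *m chi_pow w k = sgn b *: (chi_pow w k *m chi_prod v s).
  exists (\sum_(l <- s) (k != l)%:R * (w k 0 * v l 0)).
  by rewrite chi_pow_prodC scalerA sgn_sqr scale1r.
exists (a + b); rewrite -mulmxA (mulmxA (chi_prod v s)) defb -scalemxAl -scalemxAr.
by rewrite -mulmxA IHs -!scalemxAr scalerA mulmxA chi_powD -sgnD addrC.
Qed.

Lemma mu_phase_neq0 v : mu_phase v != 0.
Proof. by rewrite /mu_phase; case: ifP; rewrite ?neq0Ci ?oner_eq0. Qed.

Lemma muD v w : exists2 a, a != 0 & mu v *m mu w = a *: mu (v + w).
Proof.
have [a vwa] := chi_prodD v w (enum 'I_(2 * n)).
exists (mu_phase v * mu_phase w * sgn a / mu_phase (v + w)).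
  by rewrite !mulf_neq0 ?invr_eq0 ?mu_phase_neq0 ?sgn_neq0.
rewrite !muE -!scalemxAl -!scalemxAr vwa !scalerA divfK ?mu_phase_neq0 //.
Qed.

(** The leading factor moves right to meet its second copy, with one sign per later index in the
    support of [v]. For a sorted list these pairs are the entries below the diagonal, so the
    exponent is the quadratic form of [omegaL]. *)
Lemma chi_prod_sqr v s : sorted (fun k l => (k < l)%N) s ->
  chi_prod v s *m chi_prod v s =
  (sgn (\sum_(i <- s) \sum_(l <- s) v i 0 * (l < i)%:R * v l 0))%:M.
Proof.
elim: s => [|k s IHs] /=; first by rewrite big_nil sgn0 mulmx1.
move=> path_s; have k_lt : all (fun l => k < l)%N s.
  by apply: order_path_min path_s => ? ? ?; apply: ltn_trans.
(* No index of the list lies below its head [k], so the row [i = k] contributes nothing; the column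
   [l = k] is the sign of the move. *)
rewrite big_cons big_cons ltnn mulr0 mul0r add0r [X in sgn (X + _)]big1_seq; last first.
  by move=> l /= /(allP k_lt) lt_kl; rewrite ltnNge (ltnW lt_kl) mulr0 mul0r.
under eq_bigr do rewrite big_cons; rewrite big_split add0r /= sgnD.
rewrite mulmxA chi_pow_prodC -!scalemxAl -!mulmxA (mulmxA (chi_pow _ _) (chi_pow _ _)).
rewrite chi_powD (_ : chi_pow (v + v) k = 1%:M) ?mul1mx; last first.
  by rewrite bvec_addrr /chi_pow mxE.
rewrite IHs ?(path_sorted path_s) // scale_scalar_mx; congr (sgn _ * _)%:M.
rewrite !big_seq; apply: eq_bigr => l /(allP k_lt) lt_kl.
by rewrite lt_kl mulr1 (_ : k != l) ?mul1r 1?mulrC //;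
  apply: contraTneq lt_kl => ->; rewrite ltnn.
Qed.

(** The phase is chosen for this: its square cancels the sign of [chi_prod_sqr]. *)
Lemma mu_sqr v : mu v *m mu v = 1%:M.
Proof.
rewrite muE -scalemxAl -scalemxAr chi_prod_sqr; last first.
  by have := iota_ltn_sorted 0 (2 * n); rewrite -val_enum_ord sorted_map.
rewrite scalerA scale_scalar_mx; congr _%:M.
rewrite (_ : \sum_(i <- _) _ = mu_expt v).
  rewrite /mu_phase; case: (F2_cases (mu_expt v)) => -> /=; last first.
    by rewrite sgn1 -expr2 sqrCi mulrNN mulr1.
  by rewrite sgn0 !mulr1.
rewrite /mu_expt mxE big_enum /=; under eq_bigr do rewrite big_enum /=.
rewrite exchange_big; apply: eq_bigr => l _ /=; rewrite mxE mulr_suml.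
by apply: eq_bigr => i _; rewrite !mxE; case: (l < i)%N.
Qed.

Lemma chi_prod_unitary v s : chi_prod v s *m adj (chi_prod v s) = 1%:M.
Proof.
elim: s => [|k s IHs] /=; first by rewrite adj1 mulmx1.
rewrite adjM mulmxA -(mulmxA (chi_pow v k)) IHs mulmx1 /chi_pow.
by case: ifP; rewrite ?adj1 ?mulmx1 // chiP.1 chi_sqr.
Qed.

(** [mu v] is unitary and an involution, so its adjoint is its inverse, which is itself. *)
Lemma adj_mu v : adj (mu v) = mu v.
Proof.
have mu_adj : mu v *m adj (mu v) = 1%:M.
  rewrite muE adjZ -scalemxAl -scalemxAr chi_prod_unitary scalerA scalemx1.
  by congr _%:M; rewrite /mu_phase; case: ifP; rewrite ?rmorph1 ?mulr1 //
    conjCi mulrN -expr2 sqrCi opprK.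
by rewrite -[LHS]mul1mx -(mu_sqr v) -mulmxA mu_adj mulmx1.
Qed.

Lemma mu_0 : mu 0 = 1%:M.
Proof.
have : mu 0 = mu_phase 0 *: 1%:M.
  rewrite muE; congr (_ *: _); elim: (enum _) => //= k s ->.
  by rewrite /chi_pow mxE mul1mx.
rewrite /mu_phase (_ : mu_expt 0 = 0) ?scale1r //.
by rewrite /mu_expt mulmx0 mxE.
Qed.

End Majorana.

(** * Twirling and traces over cosets *)

Section ErrorBasis.
Variables (C : numClosedFieldType) (n : nat).
Local Notation V := (bvec n).
Local Notation sgn := (@sgn C).
Local Notation j := (jvec n).
Variables (mu : V -> 'M[C]_(2 ^ n)) (Pi : 'M[C]_(2 ^ n)).
Implicit Types v w : V.
(** The rest of the argument uses only these relations; the generators [chi] return in the final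
    theorem. *)
Hypotheses (n_gt0 : (0 < n)%N)
  (mu_comm : forall v w, mu v *m mu w = sgn (sform v w) *: (mu w *m mu v))
  (muD : forall v w, exists2 a, a != 0 & mu v *m mu w = a *: mu (v + w))
  (mu_sqr : forall v, mu v *m mu v = 1%:M)
  (adj_mu : forall v, adj (mu v) = mu v)
  (mu_0 : mu 0 = 1%:M)
  (PiE : Pi = 2%:R^-1 *: (1%:M + mu j)).

(** [assoc_map] with the family [mu] kept abstract. *)
Definition conj_map (U : 'M[C]_(2 ^ n)) (S : V -> V) : Prop :=
  exists c : V -> C, forall v, U *m mu v *m adj U = c v *: mu (S v).

Lemma mu_unitary v : unitary (mu v).
Proof. by split; rewrite adj_mu mu_sqr. Qed.

Local Notation two_neq0 := (two_neq0 C).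

Definition dim : C := (2 ^ n)%:R.

Lemma dim_neq0 : dim != 0.
Proof. by rewrite pnatr_eq0 -lt0n expn_gt0. Qed.

(** For [v != 0] some [mu w] anticommutes with [mu v]; conjugation by it preserves the trace and
    also negates it. *)
Lemma trace_mu v : \tr (mu v) = if v == 0 then dim else 0.
Proof.
case: eqVneq => [-> | v_neq0]; first by rewrite mu_0 mxtrace1.
have [w vw1] := sform_nondeg n_gt0 v_neq0.
have : \tr (mu v) = - \tr (mu v).
  rewrite -{1}[mu v]mulmx1 -(mu_sqr w) mulmxA (mu_comm v w) vw1 sgn1 scaleN1r mulNmx raddfN /=.
  by rewrite -mulmxA mxtrace_mulC -mulmxA mu_sqr mulmx1.
by move/eqP; rewrite -subr_eq0 opprK -mulr2n mulrn_eq0 => /eqP.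
Qed.

Lemma trace_mu_mu v w : \tr (mu v *m mu w) = if v == w then dim else 0.
Proof.
case: eqVneq => [-> | neq_vw]; first by rewrite mu_sqr mxtrace1.
have [a _ ->] := muD v w; rewrite linearZ /= trace_mu.
case: eqP => [vw0 | _]; last exact: mulr0.
by rewrite -[v](bvec_addrK w) vw0 add0r eqxx in neq_vw.
Qed.

(* The 4^n operators mu w are orthogonal, hence a basis by dimension count. *)
Lemma mu_expand (A : 'M[C]_(2 ^ n)) : A = \sum_w (dim^-1 * \tr (mu w *m A)) *: mu w.
Proof.
pose mu_ (i : 'I_#|V|) := mu (enum_val i).
pose W := \matrix_(i < #|V|) mxvec (mu_ i).
have free_W : row_free W.
  apply: inj_row_free => u uW0; apply/rowP=> j; rewrite mxE.
  have: \sum_i u 0 i *: mu_ i = 0.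
    apply: (can_inj mxvecK); rewrite linear0 -uW0 mulmx_sum_row linear_sum /=.
    by apply: eq_bigr => i _; rewrite rowK linearZ.
  move/(congr1 (fun A => \tr (A *m mu_ j))); rewrite mul0mx raddf0 mulmx_suml raddf_sum /=.
  rewrite (bigD1 j) //= big1 => [|i neq_ij].
    by rewrite addr0 -scalemxAl linearZ /= trace_mu_mu eqxx => /eqP;
       rewrite mulf_eq0 (negPf dim_neq0) orbF => /eqP.
  by rewrite -scalemxAl linearZ /= trace_mu_mu (inj_eq enum_val_inj) (negPf neq_ij) mulr0.
have full_W : row_full W.
  by rewrite /row_full (eqP free_W) card_mx muln1 card_Fp // mul2n -addnn expnD.
have [D defA] := submxP (submx_full (mxvec A) full_W).
have defA' : A = \sum_w D 0 (enum_rank w) *: mu w.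
  apply: (can_inj mxvecK); rewrite defA mulmx_sum_row linear_sum /=.
  rewrite (reindex (@enum_rank V)) /=; last by apply: onW_bij; apply: enum_rank_bij.
  by apply: eq_bigr => w _; rewrite rowK [RHS]linearZ /mu_ enum_rankK.
rewrite {1}defA'; apply: eq_bigr => w _; congr (_ *: _).
rewrite defA' mulmx_sumr raddf_sum /= (bigD1 w) //= big1 => [|u /negPf neq_uw].
  by rewrite addr0 -scalemxAr linearZ /= trace_mu_mu eqxx mulrCA mulVf ?dim_neq0 ?mulr1.
by rewrite -scalemxAr linearZ /= trace_mu_mu eq_sym neq_uw mulr0.
Qed.

Let N : C := #|[set v : V | even_wt v]|%:R.

Lemma card_evenE : 2%:R * N = dim ^+ 2.
Proof. by rewrite /N -natrM card_even // -natrX -expnM mulnC. Qed.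

Lemma card_even_neq0 : N != 0.
Proof.
have: 2%:R * N != 0 by rewrite card_evenE expf_neq0 ?dim_neq0.
by rewrite mulf_eq0 negb_or => /andP[].
Qed.

Lemma jvec_neq0 : j != 0.
Proof.
have n2_gt0 : (0 < 2 * n)%N by rewrite muln_gt0.
by apply/eqP=> /matrixP/(_ (Ordinal n2_gt0) 0); rewrite !mxE.
Qed.

Lemma Pi_mu v : even_wt v -> Pi *m mu v = mu v *m Pi.
Proof.
move=> ev; rewrite PiE -scalemxAl -scalemxAr mulmxDl mulmxDr mulmx1 mul1mx.
rewrite (mu_comm j v) sform_even ?evenj // dotjv.
by move: ev; rewrite even_wtE => /eqP->; rewrite sgn0 scale1r.
Qed.

Lemma mu_j_Pi : mu j *m Pi = Pi.
Proof. by rewrite PiE -scalemxAr mulmxDr mulmx1 mu_sqr addrC. Qed.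

Lemma adj_Pi : adj Pi = Pi.
Proof. by rewrite PiE adjZ adjD adj1 adj_mu fmorphV rmorph_nat. Qed.

Lemma trace_Pi : \tr Pi = dim / 2%:R.
Proof.
rewrite PiE linearZ /= raddfD /= mxtrace1 trace_mu (negPf jvec_neq0) addr0.
exact: mulrC.
Qed.

(** [mu j] is the identity on the range of [Pi], where the labels [v] and [v + j] therefore agree up
    to a scalar. This is how [S v = v + j] comes to count alongside [S v = v]. *)
Lemma mu_coset_Pi v w : w = v \/ w = v + j ->
  exists2 b, b != 0 & mu w *m Pi = b *: (mu v *m Pi).
Proof.
case=> ->; first by exists 1; rewrite ?oner_eq0 ?scale1r.
have [a a_neq0 vj] := muD v j; exists a^-1; first by rewrite invr_eq0.
apply: (scalerI a_neq0); rewrite scalerA mulfV // scale1r.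
by rewrite scalemxAl -vj -mulmxA mu_j_Pi.
Qed.

Lemma trace_mu_mu_Pi_eq0 v w : w != v -> w != v + j -> \tr (mu w *m mu v *m Pi) = 0.
Proof.
move=> neq_wv neq_wvj; rewrite PiE -scalemxAr linearZ /= mulmxDr mulmx1 raddfD /=.
have [a _ vj] := muD v j.
rewrite -mulmxA vj -scalemxAr linearZ /= !trace_mu_mu (negPf neq_wv) (negPf neq_wvj).
by rewrite mulr0 addr0 mulr0.
Qed.

(** The orthogonal complement of the even vectors is {0, j}. *)
Lemma sum_sgn_dot_even w :
  \sum_(v | even_wt v) sgn (dot w v) = if (w == 0) || (w == j) then N else 0.
Proof.
case: eqVneq => [->|w_neq0] /=.
  rewrite (eq_bigr (fun=> 1)) => [|v _]; last by rewrite dot0v sgn0.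
  by rewrite sumr_const /N cardsE.
case: eqVneq => [->|w_neqj]; last exact: sum_sgn_dot.
rewrite (eq_bigr (fun=> 1)) => [|v ev]; first by rewrite sumr_const /N cardsE.
by move: ev; rewrite even_wtE dotjv => /eqP->; rewrite sgn0.
Qed.

Lemma mu_conj v w : even_wt v -> mu v *m mu w *m mu v = sgn (dot w v) *: mu w.
Proof.
move=> ev; rewrite (mu_comm v w) sform_even // dotC -scalemxAl -mulmxA mu_sqr.
by rewrite mulmx1.
Qed.

(** In the basis [mu w], conjugation by [mu v] is diagonal with entries [sgn (dot w v)]; summing
    over even [v] leaves only [w = 0] and [w = j]. *)
Lemma twirl A :
  \sum_(v | even_wt v) mu v *m A *m mu v =
  (N / dim) *: (\tr A *: 1%:M + \tr (mu j *m A) *: mu j).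
Proof.
rewrite [in LHS](mu_expand A).
set x := fun w => dim^-1 * \tr (mu w *m A).
transitivity (\sum_w (x w * \sum_(v | even_wt v) sgn (dot w v)) *: mu w).
  under [RHS]eq_bigr do rewrite mulr_sumr scaler_suml.
  rewrite [RHS]exchange_big; apply: eq_bigr => v ev /=.
  rewrite mulmx_sumr mulmx_suml; apply: eq_bigr => w _.
  by rewrite -scalemxAr -scalemxAl mu_conj // scalerA.
under eq_bigr do rewrite sum_sgn_dot_even.
rewrite (bigD1 0) //= (bigD1 j) ?jvec_neq0 //= big1 => [|w /andP[/negPf w0 /negPf wj]].
  rewrite !eqxx (negPf jvec_neq0) /= addr0.
  by rewrite scalerDr !scalerA /x mu_0 mul1mx; congr (_ *: _ + _ *: _); rewrite mulrC mulrA.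
by rewrite w0 wj mulr0 scale0r.
Qed.

(* The function x_U of the header. *)
Definition conj_char (U : 'M[C]_(2 ^ n)) v : C :=
  (2%:R / dim) * \tr (U *m mu v *m adj U *m Pi *m mu v).

(** The trace of [M *m adj U], with [M] the twirl of [Pi *m U], is computed in two ways: from the
    closed form of the twirl, and term by term. *)
Lemma trace_Pi_sqr U :
  `|\tr (Pi *m U)| ^+ 2 = 2%:R^-1 * \sum_(v | even_wt v) conj_char U v.
Proof.
pose M := \sum_(v | even_wt v) mu v *m (Pi *m U) *m mu v.
(* [Pi] absorbs [mu j], so the two traces in [twirl] coincide and [1 + mu j] recombines into
   [2 Pi]. *)
have M1 : M = (2%:R * N / dim * \tr (Pi *m U)) *: Pi.
  rewrite /M twirl mulmxA mu_j_Pi PiE -scalerDr !scalerA; congr (_ *: _).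
  rewrite [RHS]mulrC !mulrA mulVf ?two_neq0 // mul1r.
  by rewrite mulrC.
have : \tr (M *m adj U) = dim * `|\tr (Pi *m U)| ^+ 2.
  rewrite M1 -scalemxAl linearZ /= normCK -trace_adj adjM adj_Pi mulrA.
  congr (_ * _); last first.
    by rewrite mxtrace_mulC.
  by rewrite card_evenE expr2 mulfK ?dim_neq0.
rewrite /M mulmx_suml raddf_sum /= => trM.
apply: (mulfI dim_neq0); rewrite -trM !mulr_sumr; apply: eq_bigr => v ev.
rewrite /conj_char (mulrA 2%:R^-1) (mulrA 2%:R^-1 2%:R).
rewrite mulVf ?two_neq0 // mul1r mulVKf ?dim_neq0 //.
by rewrite -[in RHS](mulmxA _ Pi) Pi_mu // [RHS]mxtrace_mulC !mulmxA.
Qed.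

Lemma unitary_neq0 (A : 'M[C]_(2 ^ n)) : unitary A -> A != 0.
Proof.
case=> A1 _; apply/eqP=> A0; move: A1; rewrite A0 mul0mx => /(congr1 mxtrace).
by rewrite raddf0 mxtrace1 => /esym/eqP; rewrite (negPf dim_neq0).
Qed.

(** * The character attached to one unitary *)

Section FixedUnitary.
Variables (U : 'M[C]_(2 ^ n)) (S : V -> V).
Hypotheses (uU : unitary U) (US : conj_map U S).

(** The normalisation [2 / dim] in [conj_char] is the inverse of [\tr Pi], so the character reads
    off the eigenvalue [d]. *)
Lemma conj_charE v d : U *m mu v *m adj U *m Pi = d *: (mu v *m Pi) ->
  even_wt v -> conj_char U v = d.
Proof.
move=> Uv ev; rewrite /conj_char Uv -scalemxAl linearZ /= mxtrace_mulC.
rewrite mulmxA mu_sqr mul1mx trace_Pi.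
by rewrite mulrCA -mulrA mulKf ?dim_neq0 // mulfV ?two_neq0 // mulr1.
Qed.

(** A vanishing coefficient would make a unitary matrix zero. *)
Lemma assoc_coef : exists2 c : V -> C, forall v, c v != 0 &
  forall v, U *m mu v *m adj U = c v *: mu (S v).
Proof.
have [c cP] := US; exists c => // v; apply/eqP => cv0.
have: unitary (U *m mu v *m adj U).
  by apply: unitaryM; [apply: unitaryM => //; apply: mu_unitary | apply: unitary_adj].
by move/unitary_neq0; rewrite cP cv0 scale0r eqxx.
Qed.

(** If [S v] is [v] or [v + j], [mu_coset_Pi] yields the eigenvalue relation with a nonzero factor;
    otherwise the trace defining the character vanishes. *)
Lemma conj_char_suppP v : even_wt v ->
  (conj_char U v != 0) = (S v == v) || (S v == v + j) /\
  (conj_char U v != 0 -> U *m mu v *m adj U *m Pi =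
    conj_char U v *: (mu v *m Pi)).
Proof.
move=> ev; have [c c_neq0 cP] := assoc_coef.
case Sv: ((S v == v) || (S v == v + j)).
  have [|b b_neq0 bP] := @mu_coset_Pi v (S v).
    by case/orP: Sv => /eqP; [left | right].
  have TE : U *m mu v *m adj U *m Pi = (c v * b) *: (mu v *m Pi).
    by rewrite cP -scalemxAl bP scalerA.
  by rewrite (conj_charE TE ev) mulf_neq0.
suff ->: conj_char U v = 0 by rewrite eqxx.
rewrite /conj_char cP -mulmxA Pi_mu // mulmxA -!scalemxAl linearZ /=.
rewrite trace_mu_mu_Pi_eq0 ?mulr0 //.
  by apply: contraFneq Sv => ->; rewrite eqxx.
by apply: contraFneq Sv => ->; rewrite eqxx orbT.
Qed.

Lemma conj_charD v w : even_wt v -> even_wt w -> conj_char U v != 0 -> conj_char U w != 0 ->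
  conj_char U (v + w) = conj_char U v * conj_char U w.
Proof.
move=> ev ew Tv Tw; apply: conj_charE; last by rewrite evenD.
have [a a_neq0 vw] := muD v w; apply: (scalerI a_neq0).
have -> : a *: (U *m mu (v + w) *m adj U *m Pi) = U *m (mu v *m mu w) *m adj U *m Pi.
  by rewrite vw -scalemxAr -!scalemxAl.
(* Inserting [adj U *m U = 1] splits the conjugate of a product, and [Pi] then commutes past even
   [mu]. *)
transitivity (U *m mu v *m adj U *m (U *m mu w *m adj U *m Pi)).
  by rewrite !mulmxA -(mulmxA _ (adj U) U) uU.2 mulmx1.
rewrite (conj_char_suppP ew).2 // -scalemxAr -Pi_mu // mulmxA (conj_char_suppP ev).2 //.
rewrite -scalemxAl -mulmxA Pi_mu // mulmxA vw -scalemxAl !scalerA; congr (_ *: _).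
by rewrite [RHS]mulrC (mulrC (conj_char U w)).
Qed.

Lemma conj_char0 : conj_char U 0 = 1.
Proof.
by apply: conj_charE; rewrite ?even0 // mu_0 mulmx1 uU.1 scale1r.
Qed.

Lemma conj_charj : U *m mu j = mu j *m U -> conj_char U j = 1.
Proof.
by move=> Uj; apply: conj_charE; rewrite ?evenj // scale1r Uj -(mulmxA (mu j)) uU.1 mulmx1.
Qed.

(** Orthogonality with the trivial character: a support element [w] with value other than 1 gives
    [s = conj_char U w * s], hence [s = 0]; without one, every nonzero term is 1. *)
Lemma sum_conj_char : \sum_(v | even_wt v) conj_char U v = 0 \/
  \sum_(v | even_wt v) conj_char U v = #|[set v | even_wt v && (conj_char U v != 0)]|%:R.
Proof.
set E := [set v | _]; case: (pickP [pred w in E | conj_char U w != 1]) => [w | T1]; last first.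
  right; rewrite (bigID (fun v => conj_char U v != 0)) /= [X in _ + X]big1 ?addr0; last first.
    by move=> v /andP[_]; rewrite negbK => /eqP.
  rewrite (eq_bigr (fun=> 1)) => [|v Ev]; first by rewrite sumr_const cardsE.
  by have:= T1 v; rewrite /= inE Ev => /negbFE/eqP.
rewrite /= inE => /andP[/andP[ew Tw] Tw1]; left.
set s := \sum_(v | _) _; have: s = conj_char U w * s.
  rewrite {1}/s (reindex_inj (addIr w)) mulr_sumr; apply: eq_big => v; first exact: evenD.
  rewrite evenD // => ev; have [Tv0 | Tv] := eqVneq (conj_char U v) 0; last first.
    by rewrite conj_charD // mulrC.
  (* Translation by [w] also preserves the complement of the support, since [v = (v + w) + w]. *)
  rewrite Tv0 mulr0; apply: contra_eq Tv0 => Tvw.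
  have evw : even_wt (v + w) by rewrite evenD.
  by rewrite -[v](bvec_addrK w) (conj_charD evw ew Tvw Tw) mulf_eq0 negb_or Tvw.
move/eqP; rewrite -subr_eq0 -{1}[s]mul1r -mulrBl mulf_eq0 subr_eq0 eq_sym (negPf Tw1).
by move/eqP.
Qed.

Lemma conj_char_mul_mu w v : even_wt w ->
  conj_char (U *m mu w) v = sgn (dot v w) * conj_char U v.
Proof.
move=> ew; rewrite /conj_char adjM adj_mu.
rewrite -(mulmxA U) (mulmxA (U *m _)) -(mulmxA U) mu_conj //.
by rewrite -scalemxAr -!scalemxAl linearZ /= mulrCA.
Qed.

Lemma card_conj_char_supp :
  #|[set v | even_wt v && (conj_char U v != 0)]| =
  (#|[set v : V | even_wt v & S v == v]| + #|[set v : V | even_wt v & S v == (v + j)%R]|)%N.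
Proof.
(* The two solution sets are disjoint because [j != 0]. *)
rewrite -cardsUI [X in (_ + #|pred_of_set X|)%N](_ : _ = set0) ?cards0 ?addn0; last first.
  apply/setP=> v; rewrite !inE; apply/negP => /andP[/andP[_ /eqP->] /andP[_]].
  by rewrite -subr_eq0 opprD addNKr oppr_eq0 (negPf jvec_neq0).
apply: eq_card => v; rewrite !inE -andb_orr; case ev: (even_wt v) => //=.
by rewrite (conj_char_suppP ev).1.
Qed.

End FixedUnitary.

(** * Moments over the coset of products [U *m mu w], [w] even *)

Section Coset.
Variables (U : 'M[C]_(2 ^ n)) (S : V -> V).
Hypotheses (uU : unitary U) (Uj : U *m mu j = mu j *m U) (US : conj_map U S).

Lemma conj_map_mul_mu w : conj_map (U *m mu w) S.
Proof.
have [c cP] := US; exists (fun v => sgn (sform w v) * c v) => v.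
rewrite adjM adj_mu -(mulmxA U) (mulmxA (U *m _)) -(mulmxA U) mu_comm -scalemxAl.
by rewrite -(mulmxA (mu v)) mu_sqr mulmx1 -scalemxAr -scalemxAl cP scalerA.
Qed.

Lemma sum_coset_sqr : \sum_(w | even_wt w) `|\tr (Pi *m (U *m mu w))| ^+ 2 = N.
Proof.
transitivity (2%:R^-1 * \sum_(v | even_wt v) conj_char U v *
  \sum_(w | even_wt w) sgn (dot v w)).
  transitivity (\sum_(w | even_wt w) 2%:R^-1 *
    \sum_(v | even_wt v) sgn (dot v w) * conj_char U v).
    apply: eq_bigr => w ew.
    rewrite trace_Pi_sqr.
    by congr (_ * _); apply: eq_bigr => v _; rewrite conj_char_mul_mu.
  rewrite -mulr_sumr; congr (_ * _); rewrite exchange_big; apply: eq_bigr => v _ /=.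
  by rewrite mulr_sumr; apply: eq_bigr => w _; rewrite mulrC.
under eq_bigr do rewrite sum_sgn_dot_even.
(* Only [v = 0] and [v = j] survive, each with character value 1; the two copies of [N] cancel the
   factor 1/2. *)
rewrite (bigD1 0) ?even0 //= (bigD1 j) ?evenj ?jvec_neq0 //= big1; last first.
  by move=> v /andP[/andP[_ /negPf v0] /negPf vj]; rewrite v0 vj mulr0.
rewrite !eqxx orbT conj_char0 // conj_charj // !mul1r addr0 -mulr2n -[N *+ 2]mulr_natl.
by rewrite mulKf ?two_neq0.
Qed.

(** Each squared trace [x] is 0 or [K], with [K] independent of [w] because [S] is; so
    [x ^+ t = x * K ^+ (t - 1)] for positive [t], and [sum_coset_sqr] finishes. *)
Lemma sum_coset_frame t : (0 < t)%N ->
  \sum_(w | even_wt w) `|\tr (Pi *m (U *m mu w))| ^+ (2 * t) =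
  N * ((#|[set v : V | even_wt v & S v == v]| +
        #|[set v : V | even_wt v & S v == (v + j)%R]|)%:R / 2%:R) ^+ (t - 1).
Proof.
case: t => // t _; rewrite subn1 /=; set K := _ / _.
rewrite -[in RHS]sum_coset_sqr mulr_suml; apply: eq_bigr => w ew.
rewrite exprM exprS.
have uw : unitary (U *m mu w) by exact: unitaryM (mu_unitary w).
have [->|neq0] := eqVneq (`|\tr (Pi *m (U *m mu w))| ^+ 2) 0; first by rewrite !mul0r.
congr (_ * _ ^+ _); move: neq0; rewrite trace_Pi_sqr //.
case: (sum_conj_char uw (conj_map_mul_mu w)) => ->; first by rewrite mulr0 eqxx.
by rewrite (card_conj_char_supp uw (conj_map_mul_mu w)) mulrC.
Qed.

End Coset.

(** * Averaging over the group *)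

Lemma mu_line_inj v w a b : a != 0 -> a *: mu v = b *: mu w -> v = w.
Proof.
move=> a_neq0 /(congr1 (fun A => \tr (A *m mu v))).
rewrite -!scalemxAl !linearZ /= !trace_mu_mu eqxx eq_sym; case: eqVneq => // _ /eqP.
by rewrite mulr0 mulf_eq0 (negPf a_neq0) (negPf dim_neq0).
Qed.

(** [W] has a nonzero coefficient at some [mu w]. Then [A = mu w *m W] has nonzero trace and
    commutes with every [mu v] up to a scalar, which the trace forces to be 1; hence [A] is
    scalar. *)
Lemma conj_trivial W : unitary W ->
  (forall v, exists c, W *m mu v *m adj W = c *: mu v) -> exists w a, W = a *: mu w.
Proof.
move=> uW cP; case: (pickP (fun w => \tr (mu w *m W) != 0)) => [w tr_neq0 | tr0]; last first.
  have := unitary_neq0 uW; rewrite [W]mu_expand big1 ?eqxx // => w _.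
  by have /negbFE/eqP -> := tr0 w; rewrite mulr0 scale0r.
pose A := mu w *m W; suff [x defA] : exists x, A = x *: 1%:M.
  exists w, x; rewrite -[LHS]mul1mx -(mu_sqr w) -mulmxA -/A defA.
  by rewrite -scalemxAr mulmx1.
have A_comm v : A *m mu v = mu v *m A.
  have [c cWv] := cP v.
  have Wv : W *m mu v = c *: (mu v *m W).
    by rewrite scalemxAl -cWv -mulmxA uW.2 mulmx1.
  have Av : A *m mu v = (c * sgn (sform w v)) *: (mu v *m A).
    by rewrite /A -mulmxA Wv -scalemxAr !mulmxA (mu_comm w v) -scalemxAl scalerA.
  suff c1 : c * sgn (sform w v) = 1 by rewrite Av c1 scale1r.
  have : \tr A = (c * sgn (sform w v)) * \tr A.
    rewrite -{1}[A]mulmx1 -(mu_sqr v) mulmxA Av -scalemxAl linearZ /=.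
    by rewrite -mulmxA mxtrace_mulC -mulmxA mu_sqr mulmx1.
  by rewrite -{1}[\tr A]mul1r => /(mulIf tr_neq0).
(* Every coefficient at [v != 0] vanishes: some [mu u] anticommutes with [mu v] but commutes with
   [A]. *)
exists (dim^-1 * \tr A); rewrite [LHS]mu_expand (bigD1 0) //= mu_0 mul1mx.
rewrite big1 ?addr0 // => v v_neq0.
have [u vu1] := sform_nondeg n_gt0 v_neq0.
suff ->: \tr (mu v *m A) = 0 by rewrite mulr0 scale0r.
have : \tr (mu v *m A) = - \tr (mu v *m A).
  rewrite -{1}[A]mulmx1 -(mu_sqr u) (mulmxA A) A_comm !mulmxA (mu_comm v u) vu1 sgn1.
  rewrite scaleN1r !mulNmx raddfN /=.
  by rewrite mxtrace_mulC !mulmxA mu_sqr mul1mx.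
by move/eqP; rewrite -subr_eq0 opprK -mulr2n mulrn_eq0 => /eqP.
Qed.

(** [adj U *m U'] fixes every line spanned by a [mu v], so [conj_trivial] makes it a multiple of
    some [mu w]. Both unitaries commute with [mu j], hence so does [mu w], whereas an odd [w] would
    anticommute. *)
Lemma conj_map_coset U U' S :
  unitary U -> unitary U' -> U *m mu j = mu j *m U -> U' *m mu j = mu j *m U' ->
  conj_map U S -> conj_map U' S ->
  exists w a, even_wt w /\ U' = a *: (U *m mu w).
Proof.
move=> uU uU' Uj U'j /(assoc_coef uU)[c c_neq0 cP] [c' c'P].
have uW : unitary (adj U *m U') by apply: unitaryM; [apply: unitary_adj|].
have [v | w [a W]] := conj_trivial uW.
  exists (c' v * (c v)^-1); rewrite adjM adjK -!mulmxA (mulmxA U') (mulmxA (_ *m _)).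
  rewrite c'P -scalemxAl -scalemxAr; have -> : mu (S v) = (c v)^-1 *: (U *m mu v *m adj U).
    by rewrite cP scalerA mulVf ?scale1r.
  rewrite -scalemxAl -scalemxAr scalerA !mulmxA uU.2 mul1mx -mulmxA uU.2 mulmx1.
  by [].
have U'E : U' = a *: (U *m mu w) by rewrite scalemxAr -W mulmxA uU.1 mul1mx.
have a_neq0 : a != 0.
  by apply: contraTneq (unitary_neq0 uU') => a0; rewrite U'E a0 scale0r eqxx.
exists w, a; split=> //; rewrite even_wtE; case: (F2_cases (wt w)) => [-> // | wt1].
have : mu w *m mu j = mu j *m mu w.
  have UmuE : U *m (mu w *m mu j) = U *m (mu j *m mu w).
    apply: (scalerI a_neq0); rewrite !mulmxA Uj -(mulmxA (mu j)).
    rewrite [in LHS]scalemxAl -U'E U'j U'E.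
    by rewrite -scalemxAr.
  by have := congr1 (mulmx (adj U)) UmuE; rewrite !(mulmxA (adj U)) uU.2 !mul1mx.
rewrite mu_comm /sform wtj mulr0 add0r dotC dotjv wt1 sgn1 scaleN1r => /eqP.
rewrite eq_sym -subr_eq0 opprK -mulr2n -scaler_nat scaler_eq0 (negPf two_neq0) /=.
by rewrite (negPf (unitary_neq0 (unitaryM (mu_unitary j) (mu_unitary w)))).
Qed.

Section Group.
Variables (Gp : 'M[C]_(2 ^ n) -> Prop) (G : {set {ffun V -> V}}) (reps : seq 'M[C]_(2 ^ n)).
Hypotheses (Gp1 : Gp 1%:M)
  (GpM : forall U W, Gp U -> Gp W -> Gp (U *m W))
  (Gp_adj : forall U, Gp U -> Gp (adj U))
  (Gp_unitary : forall U, Gp U -> unitary U)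
  (Gp_commj : forall U, Gp U -> U *m mu j = mu j *m U)
  (Gp_conj : forall U, Gp U -> exists S, conj_map U S)
  (Gp_mu : forall v, even_wt v -> Gp (mu v))
  (GP : forall S : {ffun V -> V}, S \in G <-> exists U, Gp U /\ conj_map U S)
  (repsP : phase_transversal Gp reps).

Lemma dim_gt0 : (0 < 2 ^ n)%N. Proof. by rewrite expn_gt0. Qed.

Lemma conj_map_uniq U U' a (S S' : {ffun V -> V}) :
  unitary U -> unitary U' -> U = a *: U' -> conj_map U S -> conj_map U' S' -> S = S'.
Proof.
move=> uU uU' UE /(assoc_coef uU)[c c_neq0 cP] [c' c'P]; apply/ffunP=> v.
apply: (@mu_line_inj _ _ (c v) (a * a^* * c' v)) => //; rewrite -cP UE adjZ.
by rewrite -!scalemxAl -scalemxAr c'P !scalerA mulrC mulrA.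
Qed.

(* For fixed W, sending (S, w) to the representative of u_S mu(w) W is a bijection from
   G x {even w} onto reps: elements of Gp inducing the same S differ by an even mu(w). *)
Lemma sum_reps W : W \in reps ->
  exists u : {ffun V -> V} -> 'M[C]_(2 ^ n),
  (forall S, S \in G -> Gp (u S) /\ conj_map (u S) S) /\
  forall g : 'M[C]_(2 ^ n) -> C,
  (forall c A, c * c^* = 1 -> g (c *: A) = g A) ->
  \sum_(U <- reps) g (U *m adj W) = \sum_(S in G) \sum_(w | even_wt w) g (u S *m mu w).
Proof.
have [reps_uniq reps_Gp reps_ex reps_inj] := repsP.
move=> Wr; have GpW := reps_Gp _ Wr; have uW := Gp_unitary GpW.
(* Choice of one group element over each [S] in [G]; the identity is a dummy value elsewhere. *)
have [|u uP] := @fin_all_exists _ (fun=> 'M[C]_(2 ^ n))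
  (fun S U => S \in G -> Gp U /\ conj_map U S).
  move=> S; case: (boolP (S \in G)) => [/GP[U UP]|_]; first by exists U.
  by exists 1%:M.
exists u; split=> // g g_phase.
pose D := [pred p : {ffun V -> V} * V | (p.1 \in G) && even_wt p.2].
have GpD p : D p -> Gp (u p.1 *m mu p.2).
  by case/andP=> /uP[Gpu _] ev; apply: GpM => //; apply: Gp_mu.
have [|h hP] := @fin_all_exists _ (fun=> 'M[C]_(2 ^ n))
  (fun p U => D p -> U \in reps /\
    exists2 c, c * c^* = 1 & U *m adj W = c *: (u p.1 *m mu p.2)).
  move=> p; case: (boolP (D p)) => [Dp|_]; last by exists 1%:M.
  have [U Ur [c UE]] := reps_ex _ (GpM (GpD _ Dp) GpW).
  exists U => _; split=> //; have uA := Gp_unitary (GpD _ Dp).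
  have uUW : unitary (U *m adj W).
    by apply: unitaryM; [apply/Gp_unitary/reps_Gp | apply: unitary_adj].
  have AE : u p.1 *m mu p.2 = c *: (U *m adj W).
    by rewrite scalemxAl -UE -mulmxA uW.1 mulmx1.
  have cc := unitary_phase dim_gt0 uA uUW AE.
  exists c^*; first by rewrite conjCK mulrC.
  by rewrite AE scalerA mulrC cc scale1r.
(* Pairs with the same representative have proportional products [u S *m mu w]: the scalar does not
   affect [S], and cancelling [u S] then determines [w]. *)
have h_inj : {in [seq p <- enum {: {ffun V -> V} * V} | D p] &, injective h}.
  move=> p q; rewrite !mem_filter => /andP[Dp _] /andP[Dq _] hpq.
  have [_ [c cc hpE]] := hP _ Dp; have [_ [d dd hqE]] := hP _ Dq.
  rewrite hpq hqE in hpE.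
  have d_neq0 : d != 0 by apply: contra_eq_neq dd => ->; rewrite mul0r eq_sym oner_eq0.
  have qE : u q.1 *m mu q.2 = (d^-1 * c) *: (u p.1 *m mu p.2).
    by rewrite -scalerA -hpE scalerA mulVf ?scale1r.
  case/andP: (Dp) => Gp1' ep; case/andP: (Dq) => Gq1 eq.
  have [_ cp] := uP _ Gp1'; have [_ cq] := uP _ Gq1.
  have S_eq : q.1 = p.1.
    apply: conj_map_uniq (Gp_unitary (GpD _ Dq)) (Gp_unitary (GpD _ Dp)) qE _ _;
      exact: conj_map_mul_mu.
  rewrite [p]surjective_pairing [q]surjective_pairing S_eq; congr (_, _).
  move: qE; rewrite S_eq => /(congr1 (mulmx (adj (u p.1)))).
  rewrite -scalemxAr !mulmxA (Gp_unitary (uP _ Gp1').1).2 !mul1mx => qE.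
  by apply/esym/(@mu_line_inj _ _ 1 (d^-1 * c)); rewrite ?oner_eq0 ?scale1r.
have reps_perm : perm_eq reps [seq h p | p <- [seq p <- enum {: {ffun V -> V} * V} | D p]].
  apply: uniq_perm => //; first by rewrite map_inj_in_uniq // filter_uniq ?enum_uniq.
  move=> U; apply/idP/mapP => [Ur | [p]]; last first.
    by rewrite mem_filter => /andP[Dp _] ->; have [] := hP _ Dp.
  (* Surjectivity: [U *m adj W] induces some [S] in [G], so it differs from [u S] by an even [mu w]
     and a scalar; the transversal has only one element in that class. *)
  have GpU := GpM (reps_Gp _ Ur) (Gp_adj GpW).
  have [S0 [c0 c0P]] := Gp_conj GpU.
  pose S := [ffun v => S0 v].
  have US : conj_map (U *m adj W) S by exists c0 => v; rewrite ffunE.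
  have GS : S \in G by apply/GP; exists (U *m adj W).
  have [Gpu cu] := uP _ GS.
  have [w [a [ew UE]]] := conj_map_coset (Gp_unitary Gpu) (Gp_unitary GpU)
    (Gp_commj Gpu) (Gp_commj GpU) cu US.
  have Dp : D (S, w) by rewrite /= GS ew.
  exists (S, w); first by rewrite mem_filter Dp mem_enum.
  have [hr [c cc hE]] := hP _ Dp.
  apply: reps_inj => //; exists (a * c^*).
  have WW : adj W *m W = 1%:M by exact: uW.2.
  rewrite -[LHS]mulmx1 -[h _]mulmx1 -WW !mulmxA UE hE -!scalemxAl scalerA -mulrA.
  by rewrite [_^* * _]mulrC cc mulr1.
rewrite (perm_big _ reps_perm) big_map big_filter big_enum_cond /= pair_big.
apply: eq_bigr => p Dp; have [_ [c cc ->]] := hP _ Dp; exact: g_phase.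
Qed.

(** [sum_reps] for the constant function 1. *)
Lemma size_reps : (size reps)%:R = #|G|%:R * N.
Proof.
have [_ _ reps_ex _] := repsP; have [W Wr _] := reps_ex _ Gp1.
have [u [_ /(_ (fun=> 1) (fun _ _ _ => erefl))]] := sum_reps Wr.
rewrite big_const_seq count_predT iter_addr_0 => ->.
rewrite (eq_bigr (fun=> N)) => [|S _]; first by rewrite sumr_const mulr_natl.
by rewrite sumr_const /N cardsE.
Qed.

Lemma frame_potential t : (0 < t)%N ->
  ((size reps)%:R ^+ 2)^-1 *
    (\sum_(U <- reps) \sum_(W <- reps) `|\tr (Pi *m (U *m adj W))| ^+ (2 * t)) =
  #|G|%:R^-1 *
    \sum_(S in G) ((#|[set v : V | even_wt v & S v == v]| +
        #|[set v : V | even_wt v & S v == (v + j)%R]|)%:R / 2%:R) ^+ (t - 1).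
Proof.
move=> t_gt0; rewrite exchange_big /=; set R := \sum_(S in G) _.
(* For fixed [W] the inner sum runs over all cosets and no longer depends on [W]. *)
have sumW W : W \in reps ->
    \sum_(U <- reps) `|\tr (Pi *m (U *m adj W))| ^+ (2 * t) = N * R.
  move=> /sum_reps[u [uP /(_ (fun A => `|\tr (Pi *m A)| ^+ (2 * t))) -> /=]].
    rewrite /R mulr_sumr; apply: eq_bigr => S /uP[Gpu uS].
    by apply: sum_coset_frame => //; [apply: Gp_unitary | apply: Gp_commj].
  move=> c A cc; have c1 : `|c| = 1.
    by apply/eqP; rewrite -sqrp_eq1 ?normr_ge0 // normCK cc.
  by rewrite -scalemxAr linearZ /= normrM c1 mul1r.
rewrite big_seq (eq_bigr (fun=> N * R)) -?big_seq //.
have size_neq0 : (size reps)%:R != 0 :> C.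
  have [_ _ reps_ex _] := repsP; have [W Wr _] := reps_ex _ Gp1.
  by rewrite pnatr_eq0; case: (reps) Wr.
rewrite big_const_seq count_predT iter_addr_0 -[N * R *+ _]mulr_natl.
rewrite expr2 invfM -mulrA mulKf //.
by rewrite size_reps invfM -mulrA mulKf ?card_even_neq0.
Qed.

End Group.
End ErrorBasis.

Theorem mainTheorem15 (C : numClosedFieldType) (n : nat)
    (chi : 'I_(2 * n) -> 'M[C]_(2 ^ n))
    (Gp : 'M[C]_(2 ^ n) -> Prop) (G : {set {ffun bvec n -> bvec n}})
    (reps : seq 'M[C]_(2 ^ n)) (t : nat) :
  (1 <= n)%N ->
  majorana chi ->
  is_subgroup Gp ->
  between_Mplus_Cp chi Gp ->
  (forall S : {ffun bvec n -> bvec n},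
      S \in G <-> exists U, Gp U /\ assoc_map chi U S) ->
  phase_transversal Gp reps ->
  (1 <= t)%N ->
  frame_pot_plus chi reps t =
    (#|G|%:R)^-1 *
    \sum_(S in G) (((f_plus S + c_plus S)%:R / 2%:R) ^+ (t - 1)).
Proof.
move=> n_gt0 chiP [Gp1 GpM GpV] [GpMu GpCl] GP repsP t_gt0.
have uGp U : Gp U -> unitary U by case/GpCl=> [[]].
have adjGp U : Gp U -> Gp (adj U).
  (* For a unitary matrix the adjoint is the group inverse. *)
  by move=> GpU; rewrite -unitary_inv; [case: (GpV U GpU) | apply: uGp].
have muGp v : even_wt v -> Gp (mu chi v).
  by move=> ev; have := GpMu 0%N v ev; rewrite expr0 scale1r.
have commGp U : Gp U -> U *m mu chi (jvec n) = mu chi (jvec n) *m U by case/GpCl.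
have mapGp U : Gp U -> exists S, conj_map (mu chi) U S by case/GpCl=> [[]].
(* [conj_map (mu chi)] and [assoc_map chi] are convertible, as are the two forms of the counts and
   of the potential. *)
exact: (frame_potential n_gt0 (mu_comm chiP) (muD chiP) (mu_sqr chiP) (adj_mu chiP)
  (mu_0 chi) (erefl (Pi_plus chi)) Gp1 GpM adjGp uGp commGp mapGp muGp GP repsP t_gt0).
Qed.
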